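(* Let $(Y,\nu)$ be a probability space and let $A_1\supset A_2\supset\cdots$ be measurable subsets of $Y$ with $\nu(A_n)\to0$ as $n\to\infty$. Let $X=Y^{\mathbb{N}\cup\{0\}}$, $\mu=\nu^{\otimes(\mathbb{N}\cup\{0\})}$, let $T\colon X\to X$ be the left shift, and let $\mathcal{B}=\{B_1\supset B_2\supset\cdots\}$ with $B_n=\{x\in X: x[0]\in A_n\}$. If $$\sum_{n=1}^\infty \frac{\big(1-\mu(B_{n})\big)^{n(1-\epsilon)}}{n}<\infty$$ for some $\epsilon>0$, then $\mathcal{H}_{\mathrm{e.a.}}(\mathcal{B})$ has full $\mu$-measure. On the other hand, if $$\sum_{n=1}^\infty\frac{\big(1-\mu(B_{n})\big)^n}{n}=\infty,$$ then $\mathcal{H}_{\mathrm{e.a.}}(\mathcal{B})$ has zero $\mu$-measure.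
   Context: $\mathbb{N}=\{1,2,3,\dots\}$. Points of $X$ are sequences $x=(x[0],x[1],x[2],\dots)$, and $(Tx)[i]=x[i+1]$. Put $O_m(x)=\{Tx,T^2x,\dots,T^mx\}$. The eventually always hitting set is $$\mathcal{H}_{\mathrm{e.a.}}(\mathcal{B})=\{x\in X: O_m(x)\cap B_m\neq\varnothing\text{ for all but finitely many }m\in\mathbb{N}\}.$$ *)

(* Defs.v *)
From HB Require Import structures.
From mathcomp Require Import all_boot all_order all_algebra.
From mathcomp Require Import all_classical all_reals all_analysis.
Set Implicit Arguments.
Unset Strict Implicit.
Unset Printing Implicit Defensive.
Import Order.TTheory GRing.Theory Num.Theory.
Import numFieldNormedType.Exports.
Local Open Scope classical_set_scope.
Local Open Scope ring_scope.

Definition coord_preimages (d : measure_display) (Y : measurableType d) :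
    set (set (nat -> Y)) :=
  \bigcup_i preimage_set_system setT (fun x : nat -> Y => x i) measurable.

(* Sequences x[0], x[1], ... with the product sigma-algebra. *)
Definition seqspace (d : measure_display) (Y : measurableType d) :=
  g_sigma_algebraType (@coord_preimages d Y).

(* The library has no infinite product measure.  As the finite-dimensional
   measurable rectangles form a pi-system generating the product sigma-algebra,
   this predicate determines mu on all measurable sets; the Kolmogorov extension
   theorem for product measures provides one for every nu. *)
Definition is_product_probability (d : measure_display) (Y : measurableType d)
    (R : realType) (nu : probability Y R) (mu : probability (seqspace Y) R) :
    Prop :=
  forall (n : nat) (C : nat -> set Y),
    (forall i, (i < n)%N -> measurable (C i)) ->
    mu [set x : nat -> Y | forall i, (i < n)%N -> C i (x i)] =
    (\prod_(i < n) nu (C i))%E.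

Definition left_shift (Y : Type) (x : nat -> Y) : nat -> Y := fun i => x i.+1.

Definition orbit_segment (X : Type) (T : X -> X) (m : nat) (x : X) : set X :=
  [set iter k T x | k in [set k | (1 <= k <= m)%N]].

Definition eventually_always_hitting (X : Type) (T : X -> X)
    (B : nat -> set X) : set X :=
  [set x | \forall m \near \oo, orbit_segment T m x `&` B m !=set0].

(* Main.v *)
Require Import Defs.
From HB Require Import structures.
From mathcomp Require Import all_boot all_order all_algebra.
From mathcomp Require Import all_classical all_reals all_analysis.
From mathcomp Require Import measurable_realfun ring lra zify.
Set Implicit Arguments.
Unset Strict Implicit.
Unset Printing Implicit Defensive.
Import Order.TTheory GRing.Theory Num.Theory.
Import numFieldNormedType.Exports.
Local Open Scope classical_set_scope.
Local Open Scope ring_scope.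

(* Let E_m be the event that x[1], ..., x[m] all miss A_m, so that
   mu(E_m) = q_m ^ m with q_m = 1 - nu(A_m); the set of eventually always
   hitting points is the complement of limsup E_m.

   Convergence: fix L with 1/L <= eps and let G_n be the event that the first
   n - floor(n/L) coordinates miss A_n.  By monotonicity of (A_n), E_m is
   contained in G_n for all n in [m, m + m/L], so on E_m the sum of
   1_{G_n} / n over n >= m is at least 1/(2L).  Markov's inequality bounds the
   measure of the union of the E_m, m >= M, by 2L times a tail of a convergent
   series.

   Divergence: let S_N be the sum of 1_{E_n} / n over 1 <= n < N and a_N its
   mean.  For m <= n the event E_m /\ E_n has probability q_m^m q_n^(n-m), and
   q^(n-m) <= (1 + delta) q^n + (1 + delta)^(1 - floor(n/m)), whence
   E[S_N^2] <= (1 + delta) a_N^2 + 2 (1 + 1/delta) a_N.  As a_N -> oo,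
   Chebyshev's inequality shows that S_N stays bounded with probability at most
   4 delta, for every delta > 0; but S_N is bounded wherever only finitely many
   E_n occur. *)

(** * Deterministic estimates for the second moment *)

(* Decoupling: either [q ^+ m] is close to 1, and dropping it costs a factor
   [1 + delta], or it is so small that [q ^+ (n - m)] decays geometrically
   in [n %/ m]. *)
Lemma expr_subn_le (R : realFieldType) (q delta : R) (m n : nat) :
  0 <= q <= 1 -> 0 < delta -> (0 < m <= n)%N ->
  q ^+ (n - m) <= (1 + delta) * q ^+ n + (1 + delta)^-1 ^+ (n %/ m).-1.
Proof.
move=> /andP[q0 q1] d0 /andP[m0 mn].
have r0 : 0 <= (1 + delta)^-1 by rewrite invr_ge0; lra.
have [le1|lt1] := lerP 1 ((1 + delta) * q ^+ m).
  apply: ler_wpDr; first exact: exprn_ge0.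
  rewrite -{2}(subnK mn) exprD mulrCA.
  by apply: ler_peMr => //; exact: exprn_ge0.
apply: ler_wpDl; first by rewrite mulr_ge0 ?exprn_ge0//; lra.
have qm : q ^+ m <= (1 + delta)^-1.
  by rewrite -[leRHS]mul1r ler_pdivlMr 1?mulrC ?ltW//; lra.
apply: (@le_trans _ _ (q ^+ (m * (n %/ m).-1))).
  by apply: ler_wiXn2l => //; have := leq_divM n m; nia.
by rewrite exprM lerXn2r// nnegrE exprn_ge0.
Qed.

(** Cut the range into blocks of length [m] on which [n %/ m] is constant. Since [1 / n <= 1 / m],
    the block where it equals [j.+1] contributes at most [r ^+ j], and a geometric series
    remains. *)
Lemma sum_expr_divn_le (R : realFieldType) (r : R) (m N : nat) :
  0 <= r < 1 -> (0 < m)%N ->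
  \sum_(m <= n < N) r ^+ (n %/ m).-1 / n%:R <= (1 - r)^-1.
Proof.
move=> /andP[r0 r1] m0.
have w0 n : 0 <= r ^+ (n %/ m).-1 / n%:R by rewrite divr_ge0 ?exprn_ge0.
have blocks J : \sum_(m <= n < m * J.+1) r ^+ (n %/ m).-1 / n%:R <=
    \sum_(j < J) r ^+ j.
  elim: J => [|J ih]; first by rewrite muln1 big_geq// big_ord0.
  rewrite (@big_cat_nat _ _ _ (m * J.+1)) ?leq_pmulr//=; last first.
    by rewrite leq_mul2l leqnSn orbT.
  rewrite big_ord_recr/= lerD//.
  apply: (@le_trans _ _ (\sum_(m * J.+1 <= n < m * J.+2) r ^+ J / m%:R)).
    apply: ler_sum_nat => n /andP[nl nr].
    have -> : (n %/ m)%N = J.+1.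
      by apply/eqP; rewrite eqn_leq -ltnS ltn_divLR ?leq_divRL// mulnC nr mulnC.
    apply: ler_wpM2l; first exact: exprn_ge0.
    rewrite lef_pV2 ?posrE ?ltr0n ?ler_nat//; nia.
  rewrite sumr_const_nat -mulnBr subSnn muln1 -[leLHS]mulr_natr divfK//.
  by rewrite pnatr_eq0 -lt0n.
apply: (@le_trans _ _ (\sum_(m <= n < m * N.+1) r ^+ (n %/ m).-1 / n%:R)).
  have [mN|Nm] := leqP m N; last first.
    by rewrite big_geq ?sumr_ge0// ltnW.
  rewrite [leRHS](@big_cat_nat _ _ _ N)//=; last by nia.
  by rewrite lerDl sumr_ge0.
apply: (le_trans (blocks N)).
rewrite -[leRHS]mul1r ler_pdivlMr ?subr_gt0// mulrC -opprB mulNr -subrX1 opprB.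
by rewrite gerBl exprn_ge0.
Qed.

Lemma second_moment_sum_le (R : realFieldType) (q : nat -> R)
    (b : nat -> nat -> R) (delta : R) (N : nat) :
  (forall n, 0 <= q n <= 1) -> 0 < delta ->
  (forall m n, b m n = b n m) ->
  (forall m n, (0 < m <= n)%N -> b m n = q m ^+ m * q n ^+ (n - m)) ->
  \sum_(1 <= m < N) \sum_(1 <= n < N) m%:R^-1 * n%:R^-1 * b m n <=
    (1 + delta) * (\sum_(1 <= n < N) n%:R^-1 * q n ^+ n) ^+ 2 +
    2 * (1 + delta^-1) * \sum_(1 <= n < N) n%:R^-1 * q n ^+ n.
Proof.
move=> q01 d0 bC bE; set a := \sum_(1 <= n < N) n%:R^-1 * q n ^+ n.
pose r := (1 + delta)^-1.
have r0 : 0 <= r by rewrite invr_ge0; lra.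
have r1 : r < 1 by rewrite invf_lt1; lra.
pose w m n : R := if (m <= n)%N then r ^+ (n %/ m).-1 / n%:R else 0.
pose u n := n%:R^-1 * q n ^+ n.
have w0 m n : 0 <= w m n.
  by rewrite /w; case: ifP => // _; rewrite divr_ge0 ?exprn_ge0.
have u0 n : 0 <= u n.
  by rewrite mulr_ge0 ?invr_ge0 ?exprn_ge0//; case/andP: (q01 n).
have key m n : (0 < m <= n)%N ->
    m%:R^-1 * n%:R^-1 * b m n <= (1 + delta) * (u m * u n) + u m * w m n.
  move=> /[dup] mn /andP[m0 lemn]; rewrite bE// /u /w lemn.
  have := ler_wpM2l _ (expr_subn_le (q01 n) d0 mn).
  move=> /(_ (u m * n%:R^-1)); rewrite mulr_ge0 ?invr_ge0// => /(_ isT).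
  rewrite -/r /u; set X := r ^+ _.
  by move=> h; rewrite (le_trans _ (le_trans h _))// le_eqVlt;
    apply/orP; left; apply/eqP; ring.
have sumw : \sum_(1 <= m < N) \sum_(1 <= n < N) u m * w m n <= (1 + delta^-1) * a.
  rewrite mulr_sumr; apply: ler_sum_nat => m /andP[m1 mN].
  rewrite -mulr_sumr mulrC; apply: ler_wpM2r; first exact: u0.
  rewrite (@big_cat_nat _ _ _ m)//=; last exact: ltnW.
  rewrite big_nat big1 ?add0r; last first.
    by move=> n /andP[_ nm]; rewrite /w leqNgt nm.
  rewrite (eq_big_nat _ _ (F2 := fun n => r ^+ (n %/ m).-1 / n%:R)); last first.
    by move=> n /andP[mn _]; rewrite /w mn.
  apply: (le_trans (sum_expr_divn_le _ _ _)) => //; first by rewrite r0.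
  rewrite le_eqVlt; apply/orP; left; apply/eqP; rewrite /r; field.
  by rewrite !lt0r_neq0//; lra.
(* Both error terms are added for every pair, which makes the bound symmetric; exchanging the sums
   then turns them into twice [sumw]. *)
apply: (@le_trans _ _ (\sum_(1 <= m < N) \sum_(1 <= n < N)
    ((1 + delta) * (u m * u n) + (u m * w m n + u n * w n m)))).
  apply: ler_sum_nat => m /andP[m1 _]; apply: ler_sum_nat => n /andP[n1 _].
  have [mn|/ltnW nm] := leqP m n.
    apply: (le_trans (key _ _ _)); rewrite ?m1//.
    by rewrite addrA lerDl mulr_ge0.
  rewrite bC [m%:R^-1 * _]mulrC.
  apply: (le_trans (key _ _ _)); rewrite ?n1//.
  by rewrite [u n * u m]mulrC lerD2l lerDr mulr_ge0.
under eq_bigr do rewrite big_split/= -mulr_sumr -mulr_sumr big_split/=.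
rewrite !big_split/= -mulr_sumr -mulr_suml -/a -expr2 lerD2l.
rewrite [X in _ + X]exchange_big/= -mulrA [2 * _]mulr_natl mulr2n.
exact: lerD.
Qed.

(** * Weighted sums of indicators and Chebyshev's inequality *)

Lemma integral_lincomb_indic d (T : measurableType d) (R : realType)
    (P : probability T R) (I : Type) (s : seq I) (c : I -> R) (E : I -> set T) :
  (forall i, 0 <= c i) -> (forall i, measurable (E i)) ->
  (\int[P]_x (\sum_(i <- s) c i * \1_(E i) x)%:E =
   (\sum_(i <- s) c i * fine (P (E i)))%:E)%E.
Proof.
move=> c0 mE; rewrite -sumEFin.
under eq_integral do rewrite -sumEFin.
rewrite ge0_integral_sum//; last 2 first.
- move=> i; apply/measurable_EFinP; exact: measurable_funM.
- by move=> i x _; rewrite lee_fin mulr_ge0.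
apply: eq_bigr => i _.
under eq_integral do rewrite EFinM.
rewrite ge0_integralZl_EFin//; last exact/measurable_EFinP.
by rewrite integral_indic// setIT EFinM fineK// fin_num_measure.
Qed.

Lemma measurable_lincomb_indic d (T : measurableType d) (R : realType)
    (I : Type) (s : seq I) (c : I -> R) (E : I -> set T) :
  (forall i, measurable (E i)) ->
  measurable_fun setT (fun x => \sum_(i <- s) c i * \1_(E i) x).
Proof.
move=> mE; apply: measurable_sum => i; exact: measurable_funM.
Qed.

(** Chebyshev: on this event the sum is at least [a / 2] below its mean [a], and its variance is at
    most [b - a ^+ 2]. *)
Lemma lower_half_le d (T : measurableType d) (R : realType)
    (P : probability T R) (I : Type) (s : seq I) (c : I -> R) (E : I -> set T)
    (a b : R) :
  (forall i, 0 <= c i) -> (forall i, measurable (E i)) ->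
  a = \sum_(i <- s) c i * fine (P (E i)) ->
  \sum_(i <- s) \sum_(j <- s) c i * c j * fine (P (E i `&` E j)) <= b ->
  0 < a ->
  fine (P [set x | \sum_(i <- s) c i * \1_(E i) x <= a / 2]) <=
    4 * (b - a ^+ 2) / a ^+ 2.
Proof.
move=> c0 mE aE bE a0.
pose S x := \sum_(i <- s) c i * \1_(E i) x.
pose F := [set x | S x <= a / 2].
(* The square of [S] is again a combination of indicators, indexed by pairs, so its integral comes
   from the same formula. *)
pose s2 := [seq (i, j) | i <- s, j <- s].
pose c2 (p : I * I) := c p.1 * c p.2.
pose E2 (p : I * I) := E p.1 `&` E p.2.
have mS : measurable_fun setT S by exact: measurable_lincomb_indic.
have mF : measurable F by rewrite -[F]setTI; exact: measurable_fun_le.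
have S0 x : 0 <= S x by apply: sumr_ge0 => i _; rewrite mulr_ge0.
have c20 p : 0 <= c2 p by rewrite mulr_ge0.
have mE2 p : measurable (E2 p) by exact: measurableI.
have S2E x : S x ^+ 2 = \sum_(p <- s2) c2 p * \1_(E2 p) x.
  rewrite big_allpairs/= expr2 mulr_suml; apply: eq_bigr => i _.
  rewrite mulr_sumr; apply: eq_bigr => j _.
  by rewrite /c2/E2/= indicI/= mulrACA.
have intS : (\int[P]_x (S x)%:E = a%:E)%E by rewrite integral_lincomb_indic// -aE.
have intS2 : (\int[P]_x (S x ^+ 2)%:E <= b%:E)%E.
  under eq_integral do rewrite S2E.
  by rewrite integral_lincomb_indic// lee_fin big_allpairs.
have mS2 : measurable_fun setT (fun x => S x ^+ 2) by exact: measurable_funX.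
have mFi : measurable_fun setT (\1_F : T -> R) by exact: measurable_indic.
have ha2 : 0 <= a ^+ 2 / 4 by rewrite divr_ge0// sqr_ge0.
(* The pointwise bound is [(a^2/4) 1_F <= (S - a)^2], with the cross term
   moved to the left so that both sides are integrals of nonnegative functions. *)
have ineq : (\int[P]_x ((a ^+ 2 / 4 * \1_F x)%:E + (2 * a * S x)%:E) <=
             \int[P]_x ((S x ^+ 2)%:E + (a ^+ 2)%:E))%E.
  apply: ge0_le_integral => //.
  - by move=> x _; rewrite -EFinD lee_fin addr_ge0// mulr_ge0//; lra.
  - by apply: emeasurable_funD; apply/measurable_EFinP; exact: measurable_funM.
  - by apply: emeasurable_funD; apply/measurable_EFinP.
  move=> x _; rewrite -!EFinD lee_fin.
  have := sqr_ge0 (S x - a).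
  rewrite indicE; case: (boolP (x \in F)) => [|_] /=; last by nra.
  by rewrite inE /F/= => h; nra.
rewrite ge0_integralD// in ineq; last 4 first.
- by move=> x _; rewrite lee_fin mulr_ge0.
- by apply/measurable_EFinP; exact: measurable_funM.
- by move=> x _; rewrite lee_fin mulr_ge0//; lra.
- by apply/measurable_EFinP; exact: measurable_funM.
rewrite ge0_integralD// in ineq; last 3 first.
- by move=> x _; rewrite lee_fin sqr_ge0.
- exact/measurable_EFinP.
- by move=> x _; rewrite lee_fin sqr_ge0.
have intF : (\int[P]_x (a ^+ 2 / 4 * \1_F x)%:E = (a ^+ 2 / 4 * fine (P F))%:E)%E.
  under eq_integral do rewrite EFinM.
  rewrite ge0_integralZl_EFin//; last exact/measurable_EFinP.
  by rewrite integral_indic// setIT [RHS]EFinM fineK// fin_num_measure.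
have int2S : (\int[P]_x (2 * a * S x)%:E = (2 * a * a)%:E)%E.
  under eq_integral do rewrite EFinM.
  rewrite ge0_integralZl_EFin//.
  - by rewrite intS EFinM.
  - by move=> x _; rewrite lee_fin.
  - by apply/measurable_EFinP.
  - by lra.
have inta : (\int[P]_x (a ^+ 2)%:E = (a ^+ 2)%:E)%E.
  by rewrite integral_cst// [X in (_ * X)%E]probability_setT mule1.
rewrite intF int2S inta in ineq.
have := le_trans ineq (leeD2r _ intS2).
rewrite -!EFinD lee_fin -/S -/F => h.
rewrite ler_pdivlMr ?exprn_gt0//; nra.
Qed.

(** * Criteria for almost surely, or almost never, finitely many events *)

Lemma eventually_notE (T : Type) (E : nat -> set T) :
  [set x | \forall m \near \oo, ~ E m x] =
  \bigcup_M \bigcap_(m in [set m | (M <= m)%N]) ~` E m.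
Proof.
apply/seteqP; split=> [x [M _ HM]|x [M _ HM]]; first by exists M.
by exists M.
Qed.

Lemma measurable_eventually_not d (T : measurableType d) (E : nat -> set T) :
  (forall m, measurable (E m)) ->
  measurable [set x | \forall m \near \oo, ~ E m x].
Proof.
move=> mE; rewrite eventually_notE.
apply: bigcup_measurable => M _; apply: bigcap_measurableType => m _.
exact: measurableC.
Qed.

Lemma probability_eventually_not_eq1 d (T : measurableType d) (R : realType)
    (P : probability T R) (E G : nat -> set T) (L : nat) :
  (0 < L)%N ->
  (forall m, measurable (E m)) -> (forall n, measurable (G n)) ->
  (forall m n, (0 < m)%N -> (m <= n <= m + m %/ L)%N -> E m `<=` G n) ->
  (\sum_(n <oo) (n%:R^-1 * fine (P (G n)))%:E < +oo)%E ->
  P [set x | \forall m \near \oo, ~ E m x] = 1%E.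
Proof.
move=> L0 mE mG EG sumG.
set H := [set x | _].
have mH : measurable H by exact: measurable_eventually_not.
pose f n x : \bar R := (n%:R^-1 * \1_(G n) x)%:E.
have f0 n x : (0 <= f n x)%E by rewrite lee_fin mulr_ge0 ?invr_ge0.
have mf n : measurable_fun setT (f n).
  by apply/measurable_EFinP; exact: measurable_funM.
have intf n : (\int[P]_x f n x = (n%:R^-1 * fine (P (G n)))%:E)%E.
  under eq_integral do rewrite /f EFinM.
  rewrite ge0_integralZl_EFin ?invr_ge0//; last exact/measurable_EFinP.
  by rewrite integral_indic// setIT [RHS]EFinM fineK// fin_num_measure.
pose g n : \bar R := (n%:R^-1 * fine (P (G n)))%:E.
have g0 n : (0 <= g n)%E by rewrite -[g n]intf; exact: integral_ge0.
(* The window from [m] to [m + m %/ L] has more than [m / L] integers, each at most [2 * m], so its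
   reciprocals sum to at least [c]. *)
pose c : R := (2 * L%:R)^-1.
have c0 : 0 < c by rewrite invr_gt0 mulr_gt0// ltr0n.
have lower m M x : (0 < M <= m)%N -> E m x ->
    (c%:E <= \sum_(M <= n <oo) f n x)%E.
  move=> /andP[M0 Mm] Emx; have m0 : (0 < m)%N := leq_trans M0 Mm.
  apply: (le_trans _ (nneseries_lim_ge (m + m %/ L).+1 _)) => //.
  rewrite (@big_cat_nat _ _ _ m)//=; last by rewrite leqW ?leq_addr.
  apply: (@le_trans _ _ (\sum_(m <= n < (m + m %/ L).+1) f n x)%E); last first.
    by rewrite leeDr// sume_ge0.
  rewrite sumEFin lee_fin.
  apply: (@le_trans _ _ (\sum_(m <= n < (m + m %/ L).+1) (2 * m%:R)^-1)).
    rewrite sumr_const_nat -[leRHS]mulr_natr /c.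
    rewrite ler_pdivlMl ?mulr_gt0 ?ltr0n//.
    rewrite ler_pdivrMr ?mulr_gt0 ?ltr0n//.
    rewrite -!natrM ler_nat.
    have := ltn_ceil m L0; nia.
  apply: ler_sum_nat => n mn.
  have -> : \1_(G n) x = 1 :> R.
    by rewrite indicE mem_set//; apply: (EG m) => //; rewrite -ltnS.
  rewrite mulr1 lef_pV2 ?posrE ?mulr_gt0 ?ltr0n//; last by lia.
  rewrite -natrM ler_nat; have := leq_div m L; lia.
have tail M : (0 < M)%N -> (c%:E * P (~` H) <= \sum_(M <= n <oo) g n)%E.
  move=> M0.
  have -> : (\sum_(M <= n <oo) g n =
             \int[P]_x (\sum_(M <= n <oo) f n x))%E.
    under eq_integral do rewrite -nneseries_addn//.
    rewrite integral_nneseries// -nneseries_addn//.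
    by apply: eq_eseriesr => n _; rewrite intf.
  have mHC : measurable (~` H) by exact: measurableC.
  rewrite -[X in (c%:E * P X)%E]setIT -integral_indic//.
  rewrite -ge0_integralZl_EFin ?(ltW c0)//; last exact/measurable_EFinP.
  apply: ge0_le_integral => //.
  - by move=> x _; rewrite -EFinM lee_fin mulr_ge0// ltW.
  - by apply/measurable_EFinP; exact: measurable_funM.
  - under eq_fun do rewrite -nneseries_addn//.
    apply: (@ge0_emeasurable_sum _ _ _ setT (fun n => f (n + M)) xpredT) => //.
  move=> x _; rewrite indicE; case: (boolP (x \in ~` H)) => [|_]; last first.
    by rewrite mule0 nneseries_ge0.
  rewrite inE mule1 /H/= => nH.
  have [m Mm Em] : exists2 m, (M <= m)%N & E m x.
    apply: contrapT => nE; apply: nH; exists M => // m/= Mm Emx.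
    by apply: nE; exists m.
  by apply: (lower m) => //; rewrite M0.
have PHC0 : P (~` H) = 0%E.
  have cvg0 := nneseries_tail_cvg sumG (fun n _ => g0 n).
  have : (c%:E * P (~` H) <= 0)%E.
    rewrite -(cvg_lim _ cvg0)//; apply: lime_ge.
      by apply/cvg_ex; exists 0%E.
    by exists 1%N => // M /= M1; exact: tail.
  rewrite pmule_rle0// => PH; apply/eqP; rewrite eq_le PH; exact: measure_ge0.
by rewrite -[H]setCK probability_setC ?PHC0 ?sube0//; exact: measurableC.
Qed.

(** It suffices that each set [HM], where no [E m] with [m >= M] occurs, is null. There the weighted
    count stays at most [M], while its mean [a N] is unbounded. *)
Lemma probability_eventually_not_eq0 d (T : measurableType d) (R : realType)
    (P : probability T R) (E : nat -> set T) (q : nat -> R) :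
  (forall m, measurable (E m)) -> (forall n, 0 <= q n <= 1) ->
  (forall m n, (0 < m <= n)%N ->
    fine (P (E m `&` E n)) = q m ^+ m * q n ^+ (n - m)) ->
  (\sum_(1 <= n <oo) (n%:R^-1 * q n ^+ n)%:E = +oo)%E ->
  P [set x | \forall m \near \oo, ~ E m x] = 0%E.
Proof.
move=> mE q01 PE div.
pose a N := \sum_(1 <= n < N) n%:R^-1 * q n ^+ n.
have u0 n : 0 <= n%:R^-1 * q n ^+ n.
  by rewrite mulr_ge0 ?invr_ge0 ?exprn_ge0//; case/andP: (q01 n).
have a_unbounded C : exists N, C < a N.
  apply: contrapT => nC.
  suff : (\sum_(1 <= n <oo) (n%:R^-1 * q n ^+ n)%:E <= C%:E)%E by rewrite div.
  apply: lime_le; first by apply: is_cvg_nneseries => n _ _; rewrite lee_fin.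
  apply: nearW => N; rewrite sumEFin lee_fin leNgt.
  by apply/negP => CN; apply: nC; exists N.
apply/negligibleP; first exact: measurable_eventually_not.
rewrite eventually_notE; apply: negligible_bigcup => M.
set HM := \bigcap_(m in _) _.
have mHM : measurable HM.
  by apply: bigcap_measurableType => m _; exact: measurableC.
apply/negligibleP => //.
have HM_le (delta : R) : 0 < delta -> fine (P HM) <= 5 * delta.
  move=> d0.
  (* The first summand gives [M <= a N / 2]. The second makes the linear part of the Chebyshev
     bound, [8 * (1 + delta^-1) / a N], at most [delta]; the quadratic part is [4 * delta]. *)
  have [N aN] := a_unbounded (2 * M%:R + 8 * (1 + delta^-1) / delta).
  have dV : 0 < delta^-1 by rewrite invr_gt0.
  have K0 : 0 < 8 * (1 + delta^-1) / delta by rewrite divr_gt0//; lra.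
  have M0 : 0 <= M%:R :> R by [].
  have aN0 : 0 < a N by lra.
  have half := @lower_half_le _ _ _ P _ (index_iota 1 N) (fun n => n%:R^-1) E
    (a N) ((1 + delta) * a N ^+ 2 + 2 * (1 + delta^-1) * a N).
  have mF : measurable
      [set x | \sum_(n <- index_iota 1 N) n%:R^-1 * \1_(E n) x <= a N / 2].
    rewrite -[X in measurable X]setTI; apply: measurable_fun_le => //.
    exact: measurable_lincomb_indic.
  apply: (le_trans _ (le_trans (half _ _ _ _ _) _)) => //.
  - apply: fine_le; rewrite ?fin_num_measure//.
    apply: le_measure; rewrite ?inE//.
    move=> x HMx /=.
    apply: (@le_trans _ _ M%:R); last by rewrite ler_pdivlMr//; lra.
    clear - HMx.
    (* Only indices below [M] contribute, each at most 1; the minimum with [N] lets the induction go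
       through. *)
    apply: (@le_trans _ _ (minn N M)%:R); last by rewrite ler_nat geq_minr.
    elim: N => [|[|N] ih]; [by rewrite big_geq|by rewrite big_geq|].
    rewrite big_nat_recr//=.
    have [MN|NM] := leqP M N.+1.
      have -> : \1_(E N.+1) x = 0 :> R.
        by rewrite indicE memNset//; exact: HMx.
      by rewrite mulr0 addr0 (le_trans ih)// ler_nat; lia.
    have -> : minn N.+2 M = (minn N.+1 M).+1 by lia.
    rewrite -[leRHS]natr1 lerD// mulr_ile1// ?invr_ge0//.
    by rewrite invf_le1 ?ltr0n// ler1n.
  - apply: eq_big_nat => n /andP[n1 _].
    by rewrite -[E n in RHS]setIid PE ?n1/=// subnn expr0 mulr1.
  - apply: second_moment_sum_le => //.
    by move=> m n; rewrite setIC.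
  rewrite ler_pdivrMr ?exprn_gt0//.
  have : 8 * (1 + delta^-1) <= delta * a N.
    by rewrite [leRHS]mulrC -ler_pdivrMr//; lra.
  move=> /(ler_wpM2r (ltW aN0)); nra.
have PHM0 : 0 <= fine (P HM) by apply: fine_ge0; exact: measure_ge0.
suff : fine (P HM) = 0.
  by move=> h; apply/eqP; rewrite -fine_eq0 ?fin_num_measure// h.
apply/eqP; rewrite eq_le PHM0 andbT leNgt; apply/negP => p0.
by have := HM_le (fine (P HM) / 10) ltac:(lra); lra.
Qed.

(** * Avoidance events in the sequence space *)

(** Letting the index [f k] vary with the coordinate covers intersections of two avoidance events as
    well. Coordinates start at 1 because orbit segments start at [T x]. *)
Definition avoiding (Y : Type) (A : nat -> set Y) (f : nat -> nat) (K : nat) :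
    set (nat -> Y) :=
  [set x | forall k, (k < K)%N -> ~ A (f k) (x k.+1)].

Lemma measurable_coordinate d (Y : measurableType d) (C : set Y) (i : nat) :
  measurable C -> measurable ([set x | C (x i)] : set (seqspace Y)).
Proof.
move=> mC; apply: sub_sigma_algebra; exists i => //.
by exists C => //; rewrite setTI.
Qed.

Lemma measurable_avoiding d (Y : measurableType d) (A : nat -> set Y)
    (f : nat -> nat) (K : nat) :
  (forall n, measurable (A n)) ->
  measurable (avoiding A f K : set (seqspace Y)).
Proof.
move=> mA.
have -> : avoiding A f K = \bigcap_(k in [set k | (k < K)%N])
    ([set x | (~` A (f k)) (x k.+1)] : set (seqspace Y)) by [].
apply: bigcap_measurableType => k _.
by apply: measurable_coordinate; exact: measurableC.
Qed.

Lemma probability_avoiding d (Y : measurableType d) (R : realType)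
    (nu : probability Y R) (mu : probability (seqspace Y) R)
    (A : nat -> set Y) (f : nat -> nat) (K : nat) :
  is_product_probability nu mu -> (forall n, measurable (A n)) ->
  fine (mu (avoiding A f K)) = \prod_(k < K) (1 - fine (nu (A (f k)))).
Proof.
move=> mu_prod mA.
(* Coordinate 0 is unconstrained and contributes a factor 1. *)
pose C i := if i is k.+1 then ~` A (f k) else setT.
have -> : avoiding A f K = [set x | forall i, (i < K.+1)%N -> C i (x i)].
  apply/seteqP; split=> x /= h; first by case=> //= k; exact: h.
  by move=> k kK; exact: (h k.+1).
rewrite mu_prod; last by case=> [|k] _ //=; exact: measurableC.
rewrite big_ord_recl /= probability_setT mul1e.
rewrite (eq_bigr (fun k : 'I_K => (1 - fine (nu (A (f k))))%:E)) ?prodEFin//.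
move=> k _; rewrite probability_setC// EFinB fineK//.
exact: fin_num_measure.
Qed.

Lemma eventually_always_hittingE (Y : Type) (A : nat -> set Y)
    (B : nat -> set (nat -> Y)) :
  (forall n, (1 <= n)%N -> B n = [set x | A n (x 0%N)]) ->
  eventually_always_hitting (@left_shift Y) B =
  [set x | \forall m \near \oo, ~ avoiding A (fun=> m) m x].
Proof.
move=> BE.
have iterE k (x : nat -> Y) : iter k (@left_shift Y) x 0%N = x k.
  have : forall i, iter k (@left_shift Y) x i = x (i + k)%N.
    elim: k => [|k ih] i /=; first by rewrite addn0.
    by rewrite /left_shift ih addSnnS.
  by move=> ->.
have hitE m (x : nat -> Y) : (1 <= m)%N ->
    (orbit_segment (@left_shift Y) m x `&` B m !=set0) <->
    ~ avoiding A (fun=> m) m x.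
  move=> m1; split=> [[y [[k /= /andP[k1 km] <-]]]|].
    rewrite BE//= iterE => Ax; apply/existsNP; exists k.-1.
    by rewrite prednK// => /(_ km).
  move=> /existsNP[k /not_implyP[km /contrapT Ax]].
  exists (iter k.+1 (@left_shift Y) x); split; first by exists k.+1.
  by rewrite BE//= -/(iter k.+1 _ x) iterE.
(* The maximum with 1 keeps [m] in the range where [B m] is specified. *)
apply/seteqP; split=> x [N _ hN]; exists (maxn 1 N) => // m /=;
  rewrite geq_max => /andP[m1 Nm].
- by apply/hitE => //; exact: hN.
- by apply/hitE => //; exact: hN.
Qed.

(** Since [n %/ L <= n * eps], the left exponent is the larger one, and the base is at most 1. For
    [q = 0] the left side vanishes, as [1 < L] keeps its exponent positive. *)
Lemma expr_floor_le_powR (R : realType) (q eps : R) (L n : nat) :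
  0 <= q <= 1 -> (1 < L)%N -> L%:R^-1 <= eps -> (0 < n)%N ->
  q ^+ (n - n %/ L) <= q `^ (n%:R * (1 - eps)).
Proof.
move=> /andP[q0 q1] L1 Leps n0.
have [->|qn0] := eqVneq q 0.
  rewrite expr0n subn_eq0 leqNgt ltn_Pdiv//= powR_ge0//.
have qpos : 0 < q <= 1 by rewrite lt0r qn0 q0.
rewrite -powR_mulrn//; apply: (ger_powR qpos).
have L0 : 0 < L%:R :> R by rewrite ltr0n ltnW.
rewrite natrB ?leq_div// mulrBr mulr1 lerD2l lerN2.
apply: (@le_trans _ _ (n%:R / L%:R)); last exact: ler_wpM2l.
by rewrite ler_pdivlMr// -natrM ler_nat leq_divM.
Qed.

(** * Assembly of the two halves *)

(* Sequences (A_n), (B_n) are indexed by n >= 1; A 0 and B 0 play no role. *)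
Theorem theorem1p2 (d : measure_display) (Y : measurableType d) (R : realType)
    (nu : probability Y R) (A : nat -> set Y)
    (measurable_A : forall n, (1 <= n)%N -> measurable (A n))
    (decreasing_A : forall n, (1 <= n)%N -> A n.+1 `<=` A n)
    (nu_A_cvg0 : nu (A n) @[n --> \oo] --> 0%E)
    (mu : probability (seqspace Y) R)
    (mu_product : is_product_probability nu mu)
    (B : nat -> set (seqspace Y))
    (B_def : forall n, (1 <= n)%N -> B n = [set x : nat -> Y | A n (x 0%N)]) :
  ((exists eps : R, 0 < eps /\
      (\sum_(1 <= n <oo)
         ((1 - fine (mu (B n))) `^ (n%:R * (1 - eps)) / n%:R)%:E < +oo)%E) ->
    mu (eventually_always_hitting (@left_shift Y) B) = 1%E)
  /\
  ((\sum_(1 <= n <oo) ((1 - fine (mu (B n))) ^+ n / n%:R)%:E)%E = +oo%E ->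
    mu (eventually_always_hitting (@left_shift Y) B) = 0%E).
Proof.
(* Reindexing makes the hypotheses hold at every index, including the junk index 0. *)
pose A' n := A (maxn 1 n).
have A'E n : (1 <= n)%N -> A' n = A n by move=> n1; rewrite /A' (maxn_idPr n1).
have mA' n : measurable (A' n) by apply: measurable_A; rewrite leq_maxl.
have decA' m n : (0 < m <= n)%N -> A' n `<=` A' m.
  move=> /andP[m0 mn]; rewrite !A'E//; last exact: leq_trans mn.
  elim: n mn => [|n ih]; first by rewrite leqn0 => /eqP ->.
  rewrite leq_eqVlt => /predU1P[-> //|]; rewrite ltnS => mn.
  apply: subset_trans (ih mn); apply: decreasing_A; exact: leq_trans mn.
pose q n := 1 - fine (nu (A' n)).
have q01 n : 0 <= q n <= 1.
  have nu0 : 0 <= fine (nu (A' n)) by exact: fine_ge0.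
  have nu1 : fine (nu (A' n)) <= 1.
    by rewrite -lee_fin fineK ?probability_le1// fin_num_measure.
  rewrite /q; lra.
have muB n : (1 <= n)%N -> 1 - fine (mu (B n)) = q n.
  move=> n1; rewrite B_def// /q A'E//.
  have := mu_product 1%N (fun=> A n) (fun _ _ => measurable_A n n1).
  rewrite big_ord1 => <-; congr (1 - fine (mu _)).
  by apply/seteqP; split=> x /= => [h [|i] //|]; exact.
pose E m := avoiding A' (fun=> m) m.
have mE m : measurable (E m : set (seqspace Y)) by exact: measurable_avoiding.
rewrite (@eventually_always_hittingE _ A'); last first.
  by move=> n n1; rewrite B_def// A'E.
split=> [[eps [eps0 sum_fin]]|sum_infty].
- pose L := (Num.bound eps^-1).+2.
  have Leps : L%:R^-1 <= eps.
    have := archi_boundP (ltW (_ : 0 < eps^-1)); rewrite invr_gt0 => /(_ eps0) h.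
    rewrite invf_ple ?posrE//; apply: (le_trans (ltW h)).
    by rewrite ler_nat /L; lia.
  pose G n := avoiding A' (fun=> n) (n - n %/ L).
  apply: (@probability_eventually_not_eq1 _ (seqspace Y) _ mu E G L) => //.
  + by move=> n; exact: measurable_avoiding.
  (* From [(n - m) * L <= m <= n] follows [n - n %/ L <= m], so [G n] constrains only coordinates
     that [E m] does, and missing [A' m] implies missing the smaller [A' n]. *)
  + move=> m n m0 /andP[mn nm] x Ex k kn nA.
    apply: (Ex k); last by apply: (decA' m n) => //; rewrite m0.
    apply: (leq_trans kn).
    have : ((n - m) * L <= n)%N.
      have := leq_divM m L; have : (n - m <= m %/ L)%N by lia.
      nia.
    rewrite -leq_divRL//; lia.
  have GE n : fine (mu (G n)) = q n ^+ (n - n %/ L).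
    by rewrite (probability_avoiding _ _ mu_product)// prodr_const card_ord.
  have g0 n : (0 <= (n%:R^-1 * fine (mu (G n)))%:E)%E.
    by rewrite lee_fin GE mulr_ge0 ?invr_ge0 ?exprn_ge0//; case/andP: (q01 n).
  (* The term of index 0 vanishes because the inverse of 0 is 0. *)
  rewrite nneseries_recl// invr0 mul0r add0e.
  apply: le_lt_trans sum_fin; apply: lee_nneseries => //.
  case=> [|n] _; first by rewrite invr0 mul0r mulr0.
  rewrite lee_fin muB// GE mulrC ler_wpM2r ?invr_ge0//.
  exact: expr_floor_le_powR.
- apply: (@probability_eventually_not_eq0 _ (seqspace Y) _ mu E q) => //.
  + move=> m n /andP[m0 mn].
    (* The first [m] coordinates must miss the larger set [A' m], the other [n - m] only [A' n]. *)
    have -> : E m `&` E n = avoiding A' (fun k => if (k < m)%N then m else n) n.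
      apply/seteqP; split=> [x [Em En] k kn|x h].
        by case: ifPn => [km|_]; [exact: Em|exact: En].
      split=> k kN; first by have := h k (leq_trans kN mn); rewrite kN.
      have := h k kN; case: ifPn => // _; apply: contra_not.
      by apply: decA'; rewrite m0.
    rewrite (probability_avoiding _ _ mu_product)//.
    rewrite -(big_mkord xpredT
      (fun k => 1 - fine (nu (A' (if (k < m)%N then m else n))))).
    rewrite (@big_cat_nat _ _ _ m)//=; congr (_ * _).
      rewrite (eq_big_nat _ _ (F2 := fun=> q m)) ?prodr_const_nat ?subn0//.
      by move=> k /andP[_ ->].
    rewrite (eq_big_nat _ _ (F2 := fun=> q n)) ?prodr_const_nat//.
    by move=> k /andP[mk _]; rewrite ltnNge mk.
  rewrite -sum_infty; apply: eq_eseriesr => -[|n] _.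
    by rewrite invr0 mul0r mulr0.
  by rewrite muB// mulrC.
Qed.
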